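(* Let $R$ be an integral domain (not necessarily Noetherian) containing a field of characteristic zero. If each height one prime ideal of the polynomial ring $R[X]$ is a set theoretic complete intersection, then $R$ is normal.
   Context: All rings are commutative with identity; $R[X]$ denotes the polynomial ring in one variable over $R$. An ideal $I$ of a ring $A$ is a set theoretic complete intersection if there exist $n$ elements $a_1, \ldots, a_n$ in $A$ such that $\mathrm{rad}(I) = \mathrm{rad}(a_1, \ldots, a_n)$, where $n$ is the height of $I$ and $\mathrm{rad}$ denotes the radical of an ideal. An integral domain is normal if it is integrally closed in its field of fractions. *)

(* Defs.v *)
From mathcomp Require Import all_boot all_order all_algebra.
From mathcomp Require Import ring_quotient.
From mathcomp Require Import boolp classical_sets.

Set Implicit Arguments.
Unset Strict Implicit.
Unset Printing Implicit Defensive.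

Import GRing.Theory.
Local Open Scope ring_scope.
Local Open Scope classical_set_scope.

(* Ideals are arbitrary (not necessarily decidable) subsets [set A]; the
   closure predicates of ring_quotient apply to them through the classical
   membership [in P].  Note that [idealr_closed] includes 1 \notin P. *)
Definition prime_ideal (A : comNzRingType) (P : set A) : Prop :=
  idealr_closed [in P] /\ prime_idealr_closed [in P].

Definition ideal_gen (A : comNzRingType) (n : nat) (a : 'I_n -> A) : set A :=
  [set x | exists c : 'I_n -> A, x = \sum_(i < n) c i * a i].

Definition radical (A : comNzRingType) (I : set A) : set A :=
  [set x | exists k : nat, I (x ^+ k)].

(* P is the top of a chain Q_0 < ... < Q_n = P of prime ideals; the values
   of Q beyond n are irrelevant. *)
Definition prime_chain (A : comNzRingType) (P : set A) (n : nat) : Prop :=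
  exists Q : nat -> set A,
    [/\ forall i, (i <= n)%N -> prime_ideal (Q i),
        forall i, (i < n)%N -> Q i `<` Q i.+1
      & Q n = P].

(* Chains can be shortened from the bottom, so this says that the supremum of
   the lengths of the chains ending at P is exactly n (in particular finite). *)
Definition prime_height (A : comNzRingType) (P : set A) (n : nat) : Prop :=
  prime_chain P n /\ ~ prime_chain P n.+1.

(* The minimum of the heights of the prime ideals containing I is n. *)
Definition ideal_height (A : comNzRingType) (I : set A) (n : nat) : Prop :=
  (exists P, [/\ prime_ideal P, I `<=` P & prime_height P n]) /\
  (forall P, prime_ideal P -> I `<=` P -> prime_chain P n).

Definition set_theoretic_complete_intersection
    (A : comNzRingType) (I : set A) : Prop :=
  exists n : nat, ideal_height I n /\
    exists a : 'I_n -> A, radical I = radical (ideal_gen a).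

Definition normal_domain (R : idomainType) : Prop :=
  forall z : {fraction R},
    integralOver (@tofrac R) z -> exists x : R, z = @tofrac R x.

Lemma prime_chain_sub (A : comNzRingType) (P P' : set A) (n : nat) :
  prime_ideal P' -> P `<=` P' -> prime_chain P n -> prime_chain P' n.
Proof.
move=> P'p PP' [Q [Qp Qlt QP]].
exists (fun i => if (i < n)%N then Q i else P'); split; last by rewrite ltnn.
- by move=> i lein; case: ifP => // _; apply: Qp.
- move=> i ltin; rewrite ltin; case: ltnP => [_|leni]; first exact: Qlt.
  have ein : i.+1 = n by apply/eqP; rewrite eqn_leq ltin.
  have := Qlt i ltin; rewrite ein QP => -[QiP nPQ]; split=> [x /QiP/PP' //|P'Q].
  by apply: nPQ => x /PP'/P'Q.
Qed.

(* For a prime ideal the two notions of height coincide. *)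
Lemma ideal_height_prime (A : comNzRingType) (P : set A) (n : nat) :
  prime_ideal P -> ideal_height P n <-> prime_height P n.
Proof.
move=> Pp; split=> [[[P' [P'p PP' [_ nP']]] Pall]|hP].
- split; first exact: Pall.
  by move=> cP; apply/nP'/(prime_chain_sub P'p PP').
- split; first by exists P; split.
  by move=> P' P'p PP'; apply: (prime_chain_sub P'p PP'); case: hP.
Qed.

(* Main.v *)
Require Import Defs.
From mathcomp Require Import all_boot all_order all_algebra.
From mathcomp Require Import boolp classical_sets.

Set Implicit Arguments.
Unset Strict Implicit.
Unset Printing Implicit Defensive.

Import GRing.Theory.
Local Open Scope ring_scope.

(** Let [z] be a fraction integral over [R] and let [P] be the kernel of the
    evaluation of [R[X]] at [z] ([eval_kernel z]).  Since [P] is the contraction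
    of the maximal ideal generated by [X - z] over the fraction field, it is a
    prime of height one ([height_eval_kernel]), so by hypothesis
    [P = rad(f)] for a single polynomial [f]
    ([height1_complete_intersection]).

    Write [z = a / b].  The linear polynomial [b X - a] lies in [P], so [f]
    divides one of its powers; over the fraction field this forces
    [f = c (X - z)^m], with [m > 0] because [f] vanishes at [z].  Integrality of
    [z] means that [P] contains a monic polynomial; [f] divides a power of it, so
    the leading coefficient [c] of [f] is a unit of [R], and after division by
    [c] the polynomial [(X - z)^m] itself has coefficients in [R].  Its
    coefficient of degree [m - 1] is [- m z].  In characteristic zero [m] is
    invertible in [R], hence [z] is in [R]. *)

(** * Fractions and heights *)

Lemma frac_num_den (R : idomainType) (z : {fraction R}) :
  exists a b : R, b != 0 /\ tofrac b * z = tofrac a.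
Proof.
elim/quotW: z => x; exists (frac x).1, (frac x).2.
split; first exact: denom_ratioP.
unlock tofrac; rewrite -[LHS]FracField.pi_mul; apply/eqmodP.
rewrite /= FracField.equivfE /FracField.mulf.
by rewrite !numden_Ratio ?mul1r ?mulr1 ?oner_eq0 ?denom_ratioP// mulrC.
Qed.

Lemma prime_chain_le (A : comNzRingType) (P : set A) (m n : nat) :
  (m <= n)%N -> prime_chain P n -> prime_chain P m.
Proof.
move=> lemn [Q [Qprime Qlt QP]].
exists (fun i => Q (n - m + i)%N); split=> [i lei|i lti|]; last by rewrite subnK.
- by apply: Qprime; rewrite -[leqRHS](subnK lemn) leq_add2l.
- by rewrite addnS; apply: Qlt; rewrite -[leqRHS](subnK lemn) ltn_add2l.
Qed.

Lemma prime_height_inj (A : comNzRingType) (P : set A) (m n : nat) :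
  prime_height P m -> prime_height P n -> m = n.
Proof.
move=> [cm ncm] [cn ncn]; case: (ltngtP m n) => // lt.
- by case: ncm; apply: prime_chain_le lt cn.
- by case: ncn; apply: prime_chain_le lt cm.
Qed.

(** * Prime ideals *)

Section PrimeIdealMembership.

Variables (A : comNzRingType) (P : set A).
Hypothesis Pprime : prime_ideal P.

Lemma prime_ideal0 : P 0.
Proof. by case: Pprime => -[]; rewrite in_setE. Qed.

Lemma prime_ideal1 : ~ P 1.
Proof. by case: Pprime => -[_ /negP + _] _ P1; apply; rewrite in_setE. Qed.

Lemma prime_idealMr u v : P v -> P (u * v).
Proof.
move=> Pv; case: Pprime => -[P0 _ closed] _.
by rewrite -in_setE -[u * v]addr0; apply: closed => //; rewrite in_setE.
Qed.

Lemma prime_idealM u v : P (u * v) -> P u \/ P v.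
Proof.
move=> Puv; case: Pprime => _ /(_ u v); rewrite in_setE => /(_ Puv).
by case/orP; rewrite in_setE; [left | right].
Qed.

Lemma prime_idealX u k : P (u ^+ k) -> P u.
Proof.
elim: k => [|k IHk]; first by rewrite expr0 => /prime_ideal1.
by rewrite exprS => /prime_idealM[].
Qed.

End PrimeIdealMembership.

(** Heights being unique, a single generator [f] suffices up to radical; and [f]
    lies in [P], not only in its radical, because [P] is prime. *)
Lemma height1_complete_intersection (A : comNzRingType) (P : set A) :
    prime_ideal P -> prime_height P 1 ->
    set_theoretic_complete_intersection P ->
  exists2 f, P f & forall p, P p -> exists k h, p ^+ k = h * f.
Proof.
move=> Pprime ht1 [n [htn [a radP]]].
have n1 : n = 1%N.
  exact: prime_height_inj ((ideal_height_prime n Pprime).1 htn) ht1.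
subst n; exists (a ord0) => [|p Pp].
  suff: radical P (a ord0) by case=> k; apply: prime_idealX.
  rewrite radP; exists 1%N, (fun=> 1).
  by rewrite big_ord_recl big_ord0 addr0 mul1r.
have [k [c]] : radical (ideal_gen a) p by rewrite -radP; exists 1%N.
by rewrite big_ord_recl big_ord0 addr0; exists k, (c ord0).
Qed.

(** * The kernel of evaluation at a fraction *)

Section EvaluationKernel.

Variables (R : idomainType) (z : {fraction R}).
Implicit Types p q : {poly R}.

Local Notation F := (@tofrac R).
Local Notation "p ^F" := (map_poly F p) (at level 2, format "p ^F").

Definition eval_kernel : set {poly R} := [set p | p^F.[z] = 0].

Lemma tofrac_inj : injective F.
Proof. by move=> x y /eqP; rewrite tofrac_eq => /eqP. Qed.

Lemma eval_kernelC (c : R) : eval_kernel c%:P -> c = 0.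
Proof.
rewrite /eval_kernel /= map_polyC hornerC => /eqP.
by rewrite tofrac_eq0 => /eqP.
Qed.

Lemma prime_eval_kernel : prime_ideal eval_kernel.
Proof.
split; first split.
- by rewrite in_setE /eval_kernel /= rmorph0 horner0.
- apply/negP; rewrite in_setE => /eval_kernelC/eqP.
  by rewrite oner_eq0.
- move=> a u v; rewrite !in_setE /eval_kernel /= => u0 v0.
  by rewrite rmorphD rmorphM hornerD hornerM u0 v0 mulr0 addr0.
- move=> u v; rewrite in_setE /eval_kernel /= rmorphM hornerM => /eqP.
  by rewrite mulf_eq0 => /orP[] /eqP ?; apply/orP; [left | right];
     rewrite in_setE.
Qed.

Section Linear.

Variables (a b : R).
Hypotheses (b_neq0 : b != 0) (bz : F b * z = F a).

Local Notation l := (b *: 'X - a%:P).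

Lemma map_linear_den : l^F = F b *: ('X - z%:P).
Proof.
rewrite rmorphB /= map_polyZ map_polyX map_polyC /= scalerBr.
by rewrite -[_ *: z%:P]mul_polyC -polyCM bz.
Qed.

Lemma size_linear_den : size l = 2.
Proof.
rewrite -(size_map_inj_poly tofrac_inj (rmorph0 _)) map_linear_den.
by rewrite size_scale ?tofrac_eq0 // size_XsubC.
Qed.

Lemma eval_kernel_linear_den : eval_kernel l.
Proof.
by rewrite /eval_kernel /= map_linear_den hornerZ hornerXsubC subrr mulr0.
Qed.

(** Pseudo-division by [l] leaves a constant remainder, which vanishes at [z]. *)
Lemma eval_kernel_divp p :
  eval_kernel p -> exists (c : R) (h : {poly R}), c != 0 /\ c *: p = h * l.
Proof.
move=> Pp; have l0 : l != 0 by rewrite -size_poly_gt0 size_linear_den.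
have eqp := Pdiv.Idomain.divp_eq p l.
have /size1_polyC rC : (size (p %% l)%R <= 1)%N.
  by rewrite -ltnS -[leqRHS]size_linear_den ltn_modp.
exists (lead_coef l ^+ scalp p l), (p %/ l); split.
  by rewrite expf_neq0 // lead_coef_eq0.
suff r0 : p %% l = 0 by rewrite eqp r0 addr0.
rewrite rC; congr _%:P; apply: eval_kernelC; rewrite -rC.
have /(canRL (addKr _)) -> := esym eqp.
rewrite /eval_kernel /= addrC rmorphB /= map_polyZ rmorphM /= hornerD hornerN.
rewrite hornerZ hornerM (eval_kernel_linear_den : _ = 0) (Pp : _ = 0).
by rewrite !mulr0 subrr.
Qed.

(** A nonzero element of [Q] of degree [d], made divisible by [l] by a constant
    factor and then divided by [l], yields a nonzero element of [Q] of degree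
    [d - 1] unless [l] itself is in [Q].  This cannot go on forever. *)
Lemma linear_den_in_prime (Q : set {poly R}) q :
    prime_ideal Q -> (Q `<=` eval_kernel)%classic -> Q q -> q != 0 -> Q l.
Proof.
move=> Qprime QP; have [n] := ubnP (size q); elim: n q => // n IHn q.
rewrite ltnS => leqn Qq q0; have [c [h [c0 eqq]]] := eval_kernel_divp (QP _ Qq).
have /(prime_idealM Qprime)[Qh|//] : Q (h * l).
  by rewrite -eqq -mul_polyC; apply: prime_idealMr.
have h0 : h != 0.
  apply: contraNneq q0 => h0; have /eqP := eqq.
  by rewrite h0 mul0r -mul_polyC mulf_eq0 polyC_eq0 (negPf c0).
apply: (IHn h) => //; apply: leq_trans leqn.
have := size_scale q c0; rewrite eqq size_mul //; last first.
  by rewrite -size_poly_gt0 size_linear_den.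
by rewrite size_linear_den addn2 /= => <-.
Qed.

(** Once [b X - a] is in [Q], every [p] vanishing at [z] satisfies [c p] in [Q]
    for a nonzero constant [c], which is not in [Q]: no nonzero constant vanishes
    at [z].  So no prime lies strictly between [0] and the kernel. *)
Lemma prime_below_eval_kernel (Q : set {poly R}) q :
    prime_ideal Q -> (Q `<=` eval_kernel)%classic -> Q q -> q != 0 ->
  (eval_kernel `<=` Q)%classic.
Proof.
move=> Qprime QP Qq q0 p /eval_kernel_divp[c [h [c0 eqp]]].
have Ql := linear_den_in_prime Qprime QP Qq q0.
have : Q (c%:P * p) by rewrite mul_polyC eqp; apply: prime_idealMr.
by case/(prime_idealM Qprime) => // /QP/eval_kernelC/eqP; rewrite (negPf c0).
Qed.

End Linear.

Lemma height_eval_kernel : prime_height eval_kernel 1.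
Proof.
have [a [b [b0 bz]]] := frac_num_den z.
have zero_prime : prime_ideal [set (0 : {poly R})]%classic.
  split; first split.
  - by rewrite in_setE.
  - by apply/negP; rewrite in_setE => /eqP; rewrite oner_eq0.
  - by move=> x u v; rewrite !in_setE /= => -> ->; rewrite mulr0 addr0.
  - move=> u v; rewrite in_setE /= => /eqP; rewrite mulf_eq0.
    by case/orP => /eqP->; apply/orP; [left | right]; rewrite in_setE.
split.
  exists (fun i => if i is 0%N then [set 0]%classic else eval_kernel).
  split=> // [[|i] _ //|[|//] _]; first exact: prime_eval_kernel.
  split=> [_ ->|]; first exact: prime_ideal0 prime_eval_kernel.
  move=> /(_ _ (eval_kernel_linear_den bz)) l0.
  by have := size_linear_den b0 bz; rewrite l0 size_poly0.
case=> Q [Qprime Qlt Q2].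
have [_ notQ1Q0] := Qlt 0%N isT; have := Qlt 1%N isT; rewrite Q2 => -[Q1P notPQ1].
apply: notQ1Q0 => q Q1q; have [->|q0] := eqVneq q 0.
  exact: prime_ideal0 (Qprime 0%N isT).
case: notPQ1.
by apply: (prime_below_eval_kernel b0 bz) Q1q q0 => //; apply: Qprime.
Qed.

(** As [b X - a] is in the kernel, [f] divides a power of it, and over the
    fraction field the only divisors of a power of [X - z] are its lower powers,
    up to constants.  The exponent is positive since [f] vanishes at [z]. *)
Lemma eval_kernel_generator f : eval_kernel f ->
    (forall p, eval_kernel p -> exists k h, p ^+ k = h * f) ->
  exists m, f^F = F (lead_coef f) *: ('X - z%:P) ^+ m.+1.
Proof.
move=> Pf gen; have [a [b [b0 bz]]] := frac_num_den z.
have [k [h /(congr1 (map_poly F))]] := gen _ (eval_kernel_linear_den bz).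
rewrite rmorphXn rmorphM /= (map_linear_den bz) exprZn => eqf.
have : f^F %| ('X - z%:P) ^+ k.
  by rewrite -(dvdpZr _ _ (expf_neq0 k _ : F b ^+ k != 0)) ?tofrac_eq0 // eqf
             dvdp_mull.
case/dvdp_exp_XsubCP => m _ /eqpf_eq[c c0 eqfm].
have lead_f : F (lead_coef f) = c.
  rewrite -(lead_coef_map_inj tofrac_inj (rmorph0 _)) eqfm lead_coefZ.
  by rewrite (monicP (monic_exp _ (monicXsubC z))) mulr1.
case: m eqfm => [|m] eqfm; last by exists m; rewrite lead_f.
by have /eqP := Pf : _ = 0; rewrite eqfm hornerZ expr0 hornerC mulr1 (negPf c0).
Qed.

End EvaluationKernel.

(** * Normality *)

Lemma coef_exp_XsubC (A : comNzRingType) (z : A) (m : nat) :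
  (('X - z%:P) ^+ m.+1)`_m = - (z *+ m.+1).
Proof.
have := @coefPn_prod_XsubC A (nseq m.+1 z); rewrite size_nseq => /(_ isT).
by rewrite !big_nseq iter_mulr_1 iter_addr_0.
Qed.

Lemma natr_unit_char0 (K : fieldType) (A : unitRingType)
    (iota : {rmorphism K -> A}) (m : nat) :
  [pchar K] =i pred0 -> m.+1%:R \is a @GRing.unit A.
Proof.
move=> /pcharf0P char0; rewrite -(rmorph_nat iota); apply: rmorph_unit.
by rewrite unitfE char0.
Qed.

Theorem theorem2 (R : idomainType)
    (* R contains a field of characteristic zero; such a ring morphism is
       automatically injective *)
    (K : fieldType) (K_char0 : [pchar K] =i pred0) (iota : {rmorphism K -> R})
    (stci : forall P : set {poly R},
      prime_ideal P -> prime_height P 1%N ->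
      set_theoretic_complete_intersection P) :
  normal_domain R.
Proof.
move=> z [p p_monic /rootP pz].
have [f Pf gen] := height1_complete_intersection
  (prime_eval_kernel z) (height_eval_kernel z)
  (stci _ (prime_eval_kernel z) (height_eval_kernel z)).
have [m fE] := eval_kernel_generator Pf gen.
set c := lead_coef f in fE.
have c_unit : c \is a GRing.unit.
  have [k [h /(congr1 lead_coef)]] := gen _ pz.
  rewrite lead_coefM (monicP (monic_exp k p_monic)) => ch.
  by apply/unitrPr; exists (lead_coef h); rewrite mulrC.
have m_unit := natr_unit_char0 iota m K_char0.
(* The subleading coefficient of f is in R and linear in z. *)
have fm : tofrac f`_m = - (tofrac (c * m.+1%:R) * z).
  rewrite -coef_map fE coefZ coef_exp_XsubC mulrN rmorphM rmorph_nat -mulrA.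
  by rewrite mulr_natl.
have u_unit : c * m.+1%:R \is a GRing.unit by rewrite unitrM c_unit.
exists (- f`_m / (c * m.+1%:R)).
by rewrite rmorphM rmorphN /= fm opprK mulrAC -rmorphM divrr // rmorph1 mul1r.
Qed.
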